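(* Let $b\in\mathbb R\setminus\{0\}$, $g\in\mathbb R$, $\nu\in\mathbb C$, and consider the Riccati equation $$\Phi'=-\frac{b}{(z-1)^2}(1+\Phi^2)+\left(-\frac\nu z-\frac g{(z-1)^2}+\frac{\nu-\bar\nu}{z-1}\right)\Phi .$$ The variable change $\Phi=e^{i\theta}$, $z=e^{i\tau}$ transforms the restriction of this Riccati equation to the torus $\mathbb T^2=\{|\Phi|=|z|=1\}=\mathbb R^2_{\theta,\tau}/2\pi\mathbb Z^2$ to the following differential equation on the torus: $$\frac{d\theta}{d\tau}=\frac{\cos\theta+B+A\sin\tau}{\omega(1-\cos\tau)}+D,$$ where $$\omega=\frac1b,\quad B=\frac g{2b},\quad A=\frac{\operatorname{Im}\nu}{b},\quad D=-\operatorname{Re}\nu .$$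
   Context: Both equations are singular at $z=1$, i.e. at $\tau\in2\pi\mathbb Z$, and are considered away from this locus. *)

(* Defs.v *)
From Stdlib Require Import Reals.
From Coquelicot Require Import Coquelicot.

Open Scope R_scope.

Definition Cexp (z : C) : C :=
  (exp (Re z) * cos (Im z), exp (Re z) * sin (Im z)).

Definition expi (t : R) : C := Cexp (Ci * RtoC t)%C.

Definition riccati_rhs (b g : R) (nu z Phi : C) : C :=
  (- (RtoC b / (z - 1) ^ 2) * (1 + Phi ^ 2)
   + (- (nu / z) - RtoC g / (z - 1) ^ 2 + (nu - Cconj nu) / (z - 1)) * Phi)%C.

Definition torus_rhs (omega A B D theta tau : R) : R :=
  (cos theta + B + A * sin tau) / (omega * (1 - cos tau)) + D.

(* Real times off the singular locus z = 1. *)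
Definition regular (tau : R) : Prop :=
  forall k : Z, tau <> 2 * PI * IZR k.

(* Complex derivative at z of a function known only on the unit circle: in the
   difference quotient the point w tends to z along |w| = 1. *)
Definition is_derive_circle (f : C -> C) (z l : C) : Prop :=
  filterlim (fun w : C => ((f w - f z) / (w - z))%C)
    (within (fun w : C => Cmod w = 1) (locally' z)) (locally l).

(* Solutions of the Riccati equation restricted to the torus |Phi| = |z| = 1,
   over the open arc of all z = exp(i tau) with t0 < tau < t1.  Values of Phi
   off the arc are irrelevant. *)
Definition riccati_solution_on_torus
    (b g : R) (nu : C) (t0 t1 : R) (Phi : C -> C) : Prop :=
  forall tau : R, t0 < tau < t1 ->
    Cmod (Phi (expi tau)) = 1 /\
    is_derive_circle Phi (expi tau)
      (riccati_rhs b g nu (expi tau) (Phi (expi tau))).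

Definition torus_solution
    (omega A B D t0 t1 : R) (theta : R -> R) : Prop :=
  forall tau : R, t0 < tau < t1 ->
    is_derive theta tau (torus_rhs omega A B D (theta tau) tau).

(* Phi = exp(i theta) and z = exp(i tau) along the arc, with a continuous
   determination theta of the argument of Phi. *)
Definition variable_change
    (t0 t1 : R) (theta : R -> R) (Phi : C -> C) : Prop :=
  forall tau : R, t0 < tau < t1 ->
    continuous theta tau /\ Phi (expi tau) = expi (theta tau).

(* Main.v *)
Require Import Defs.
From Stdlib Require Import Reals Lra Psatz.
From Coquelicot Require Import Coquelicot.

(** On the torus [z = exp(i tau)], [Phi = exp(i theta)] one has
    [dz = i z dtau] and [dPhi = i Phi dtheta], so the Riccati equation
    [dPhi = R dz] reads [Phi dtheta = R z dtau].  The point is that [R z / Phi]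
    is real there.  With [|z| = |Phi| = 1],

      z / (z - 1)^2 = - 1 / (2 (1 - cos tau)),
      z / (z - 1)   = 1/2 - (i/2) sin tau / (1 - cos tau),
      1 + Phi^2     = 2 (Re Phi) Phi,

    and the imaginary contributions of [- nu] and of
    [(nu - conj nu) z / (z - 1)] cancel, leaving
    [(cos theta + B + A sin tau) / (omega (1 - cos tau)) + D].  This is
    [riccati_on_torus]; it settles the statement on line fields.

    To pass to solutions, two facts on derivatives are needed.  First, the
    derivative in the angle is the derivative along the circle multiplied by
    [i z] ([is_derive_circle_expi]): the map [expi] is differentiable with
    nonvanishing derivative, and near each point every [w] on the circle is
    [expi s] with [s] close to the given angle.  Second, for a continuous
    [theta] the derivatives of [expi o theta] and of [theta] determine each
    other ([is_derive_expi_comp], [is_derive_of_expi]).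

    A continuous angle along a solution [Phi] is obtained without covering
    spaces: by the same identity [f = Phi o expi] satisfies [f' = i h f] with a
    real continuous [h], so a primitive of [h], suitably normalised, is an
    angle of [f] ([continuous_angle_of_circle_curve]). *)

(** * The exponential parametrisation of the unit circle *)

Lemma expi_cos_sin (t : R) : expi t = (cos t, sin t).
Proof.
unfold expi, Cexp; simpl.
replace (0 * t - 1 * 0) with 0 by ring.
replace (0 * 0 + 1 * t) with t by ring.
now rewrite exp_0, !Rmult_1_l.
Qed.

Lemma Cmod_eq_1 (x y : R) : x ^ 2 + y ^ 2 = 1 <-> Cmod (x, y) = 1.
Proof.
split; intros H.
- unfold Cmod; simpl fst; simpl snd; rewrite H; apply sqrt_1.
- generalize (Cmod2_alt (x, y)); rewrite H; simpl; lra.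
Qed.

Lemma Cmod_expi (t : R) : Cmod (expi t) = 1.
Proof.
rewrite expi_cos_sin; apply Cmod_eq_1.
generalize (sin2_cos2 t); unfold Rsqr; lra.
Qed.

Lemma expi_neq_0 (t : R) : expi t <> 0%C.
Proof. apply Cmod_gt_0; rewrite Cmod_expi; lra. Qed.

(** * Derivatives of complex-valued functions of a real variable *)

Lemma is_derive_C_components (F : R -> C) (t : R) (l : C) :
  is_derive F t l <->
  is_derive (fun s => fst (F s)) t (fst l) /\
  is_derive (fun s => snd (F s)) t (snd l).
Proof.
split.
- intros H; split.
  + exact (filterdiff_comp' F (fun u : C => fst u) t _ _ H
      (filterdiff_linear _ (is_linear_fst (K := R_AbsRing)
         (U := R_NormedModule) (V := R_NormedModule)))).
  + exact (filterdiff_comp' F (fun u : C => snd u) t _ _ H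
      (filterdiff_linear _ (is_linear_snd (K := R_AbsRing)
         (U := R_NormedModule) (V := R_NormedModule)))).
- intros [H1 H2].
  set (E1 := ((1, 0) : prod_NormedModule R_AbsRing R_NormedModule R_NormedModule)).
  set (E2 := ((0, 1) : prod_NormedModule R_AbsRing R_NormedModule R_NormedModule)).
  assert (E : forall x y : R, plus (scal x E1) (scal y E2) = (x, y)).
  { intros x y; unfold E1, E2; cbv -[Rplus Rmult]. f_equal; ring. }
  generalize (is_derive_plus _ _ _ _ _ (is_derive_scal_l _ _ _ E1 H1)
                (is_derive_scal_l _ _ _ E2 H2)).
  rewrite E, <- surjective_pairing.
  apply is_derive_ext; intros s; rewrite E. now destruct (F s).
Qed.

Lemma is_derive_C_unique (F : R -> C) (t : R) (l1 l2 : C) :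
  is_derive F t l1 -> is_derive F t l2 -> l1 = l2.
Proof.
intros H1 H2; apply is_derive_C_components in H1, H2.
destruct H1 as [A1 B1], H2 as [A2 B2].
apply injective_projections.
- now rewrite <- (is_derive_unique _ _ _ A1), <- (is_derive_unique _ _ _ A2).
- now rewrite <- (is_derive_unique _ _ _ B1), <- (is_derive_unique _ _ _ B2).
Qed.

Lemma is_derive_expi_comp (theta : R -> R) (t m : R) :
  is_derive theta t m ->
  is_derive (fun s => expi (theta s)) t (RtoC m * (Ci * expi (theta t)))%C.
Proof.
intros H; apply is_derive_C_components; split.
- apply is_derive_ext with (fun s => cos (theta s)).
  { intros s; now rewrite expi_cos_sin. }
  rewrite expi_cos_sin; simpl.
  evar_last; [apply (is_derive_comp cos theta t _ m (is_derive_cos _) H)|].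
  cbv -[Rplus Rmult Ropp Rminus cos sin]; ring.
- apply is_derive_ext with (fun s => sin (theta s)).
  { intros s; now rewrite expi_cos_sin. }
  rewrite expi_cos_sin; simpl.
  evar_last; [apply (is_derive_comp sin theta t _ m (is_derive_sin _) H)|].
  cbv -[Rplus Rmult Ropp Rminus cos sin]; ring.
Qed.

(** The argument of [u + i v], rotated so that it vanishes at [t]: there [atan]
    of the slope is a smooth local branch, whatever the quadrant of the curve.
    The constant [a] allows for the value of the angle at [t]. *)
Lemma is_derive_atan_rotated (u v : R -> R) (a t m : R) :
  u t ^ 2 + v t ^ 2 = 1 ->
  is_derive u t (- (m * v t)) -> is_derive v t (m * u t) ->
  is_derive (fun s => a + atan ((v s * u t - u s * v t)
                              / (u s * u t + v s * v t))) t m.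
Proof.
intros E Hu Hv.
assert (E' : u t * u t + v t * v t = 1) by lra.
auto_derive.
- repeat split; try (eexists; eassumption).
  rewrite E'; lra.
- replace (Derive (fun s : R => u s) t) with (- (m * v t))
    by (symmetry; now apply is_derive_unique).
  replace (Derive (fun s : R => v s) t) with (m * u t)
    by (symmetry; now apply is_derive_unique).
  replace (v t * u t + - (u t * v t)) with 0 by ring.
  rewrite E'; field_simplify.
  transitivity (m * (u t ^ 2 + v t ^ 2)); [ring | rewrite E; ring].
Qed.

(** Continuity keeps [theta s - theta t] between [- PI / 2] and [PI / 2] near
    [t], hence equal to the [atan] of its tangent, which is a smooth function of
    [expi (theta s)]. *)
Lemma is_derive_of_expi (theta : R -> R) (t m : R) :
  continuous theta t ->
  is_derive (fun s => expi (theta s)) t (RtoC m * (Ci * expi (theta t)))%C ->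
  is_derive theta t m.
Proof.
intros Hc H; apply is_derive_C_components in H; destruct H as [H1 H2].
apply (is_derive_ext _ (fun s : R => cos (theta s))) in H1;
  [|intros s; now rewrite expi_cos_sin].
apply (is_derive_ext _ (fun s : R => sin (theta s))) in H2;
  [|intros s; now rewrite expi_cos_sin].
rewrite expi_cos_sin in H1, H2; simpl in H1, H2.
assert (Ha : is_derive (fun s => theta t +
    atan ((sin (theta s) * cos (theta t) - cos (theta s) * sin (theta t))
        / (cos (theta s) * cos (theta t) + sin (theta s) * sin (theta t)))) t m).
{ apply (is_derive_atan_rotated (fun s => cos (theta s))
           (fun s => sin (theta s))).
  - generalize (sin2_cos2 (theta t)); unfold Rsqr; lra.
  - evar_last; [exact H1 | ring].
  - evar_last; [exact H2 | ring]. }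
revert Ha; apply is_derive_ext_loc.
assert (P : 0 < PI / 2) by (generalize PI_RGT_0; lra).
apply (Hc (fun y => theta t +
    atan ((sin y * cos (theta t) - cos y * sin (theta t))
        / (cos y * cos (theta t) + sin y * sin (theta t))) = y)).
exists (mkposreal _ P); intros y Hy.
apply Rabs_lt_between in Hy; unfold minus, plus, opp in Hy; simpl in Hy.
rewrite <- sin_minus, <- cos_minus.
change (sin (y - theta t) / cos (y - theta t)) with (tan (y - theta t)).
rewrite atan_tan; lra.
Qed.

(** This form and [is_derive_circle_iff] below are first-order estimates
    without quotients, so that a circle derivative and a derivative in the
    angle can be compared by the triangle inequality. *)
Lemma is_derive_C_iff (F : R -> C) (t : R) (l : C) :
  is_derive F t l <->
  forall eps : posreal,
    locally t (fun s =>
      Cmod (F s - F t - RtoC (s - t) * l)%C <= eps * Rabs (s - t)).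
Proof.
assert (E : forall s : R,
  norm (V := prod_NormedModule R_AbsRing R_NormedModule R_NormedModule)
    (minus (minus (F s) (F t)) (scal (minus s t : R_AbsRing) l)) =
  Cmod (F s - F t - RtoC (s - t) * l)%C).
{ intros s; destruct (F s) as [a a'], (F t) as [c c'], l as [d d'].
  unfold norm; simpl; unfold prod_norm, Cmod; simpl.
  unfold norm, minus, plus, opp, scal; simpl; unfold abs, mult; simpl.
  f_equal; rewrite !Rmult_1_r, <- !Rabs_mult.
  rewrite !(Rabs_pos_eq (_ * _)) by apply Rle_0_sqr; ring. }
split.
- intros [_ H] eps.
  generalize (H t (fun P HP => HP) eps); apply filter_imp; intros s.
  rewrite <- (E s); exact (fun Hs => Hs).
- intros H; split; [apply is_linear_scal_l|].
  intros x Hx eps.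
  apply (is_filter_lim_locally_unique (V := R_NormedModule)) in Hx; subst x.
  generalize (H eps); apply filter_imp; intros s.
  rewrite <- (E s); exact (fun Hs => Hs).
Qed.

(** * Derivatives along the unit circle *)

Lemma locally_C_iff (z : C) (P : C -> Prop) :
  locally z P <->
  exists d : posreal, forall w, Cmod (w - z)%C < d -> P w.
Proof.
split.
- intros H.
  destruct (locally_norm_le_locally (V := C_NormedModule) z P H) as [d Hd].
  now exists d.
- intros [d Hd].
  apply (locally_le_locally_norm (V := C_NormedModule)); now exists d.
Qed.

Lemma is_derive_circle_iff (f : C -> C) (z l : C) :
  is_derive_circle f z l <->
  forall eps : posreal,
    within (fun w => Cmod w = 1) (locally z) (fun w =>
      Cmod (f w - f z - (w - z) * l)%C <= eps * Cmod (w - z)%C).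
Proof.
split.
- intros H eps.
  assert (L : locally l (fun q : C => Cmod (q - l)%C < eps)).
  { apply locally_C_iff; now exists eps. }
  generalize (H _ L); unfold filtermap, within, locally'.
  unfold within; apply filter_imp; intros w Hw Hm.
  destruct (Ceq_dec w z) as [->|Hne].
  { replace (f z - f z - (z - z) * l)%C with (RtoC 0) by ring.
    replace (z - z)%C with (RtoC 0) by ring.
    rewrite !Cmod_0; lra. }
  specialize (Hw Hne Hm).
  assert (Hz : (w - z)%C <> 0%C) by (intros E; apply Hne, Ceq_minus; exact E).
  replace (f w - f z - (w - z) * l)%C with (((f w - f z) / (w - z) - l) * (w - z))%C
    by (now field).
  rewrite Cmod_mult; apply Rmult_le_compat_r; [apply Cmod_ge_0|lra].
- intros H P HP; apply locally_C_iff in HP; destruct HP as [d Hd].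
  generalize (H (pos_div_2 d)); unfold filtermap, within, locally'.
  unfold within; apply filter_imp; intros w Hw Hne Hm.
  specialize (Hw Hm); apply Hd.
  assert (Hz : (w - z)%C <> 0%C) by (intros E; apply Hne, Ceq_minus; exact E).
  replace ((f w - f z) / (w - z) - l)%C with ((f w - f z - (w - z) * l) / (w - z))%C
    by (now field).
  rewrite Cmod_div by exact Hz.
  apply Cmod_gt_0 in Hz.
  apply Rle_lt_trans with (pos_div_2 d).
  + apply Rle_div_l; [exact Hz|exact Hw].
  + generalize (cond_pos d); simpl; lra.
Qed.

(** * Angles of points of the circle *)

Lemma expi_surjective (w : C) : Cmod w = 1 -> exists a : R, w = expi a.
Proof.
destruct w as [x y]; intros H; apply Cmod_eq_1 in H.
assert (Hx : -1 <= x <= 1) by nra.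
assert (Hs : sin (acos x) = Rabs y).
{ rewrite sin_acos by exact Hx.
  rewrite <- sqrt_Rsqr_abs; f_equal; unfold Rsqr; lra. }
destruct (Rle_dec 0 y) as [Hy|Hy].
- exists (acos x); rewrite expi_cos_sin, Hs, cos_acos, Rabs_pos_eq by assumption.
  reflexivity.
- exists (- acos x); rewrite expi_cos_sin, cos_neg, sin_neg, Hs, cos_acos by assumption.
  rewrite Rabs_left by lra; f_equal; ring.
Qed.

Lemma expi_plus (s t : R) : expi (s + t) = (expi s * expi t)%C.
Proof.
rewrite !expi_cos_sin, cos_plus, sin_plus; unfold Cmult; simpl.
f_equal; ring.
Qed.

Lemma expi_atan (x y : R) : 0 < x -> x ^ 2 + y ^ 2 = 1 -> expi (atan (y / x)) = (x, y).
Proof.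
intros Hx H; rewrite expi_cos_sin.
rewrite cos_atan, sin_atan.
assert (E : sqrt (1 + (y / x)²) = / x).
{ rewrite <- (sqrt_Rsqr (/ x)) by (left; now apply Rinv_0_lt_compat).
  f_equal; unfold Rsqr; field_simplify; [|lra|lra].
  replace (y ^ 2 + x ^ 2) with 1 by lra; reflexivity. }
rewrite E; f_equal; field; lra.
Qed.

(** Openness of [expi] onto the circle near [expi t]: an angle of [w] is [t]
    plus the principal argument of [w] rotated by [- t], which is continuous
    in [w]. *)
Lemma unit_circle_local_angle (t : R) (P : R -> Prop) :
  locally t P ->
  within (fun w => Cmod w = 1) (locally (expi t))
    (fun w => exists s, P s /\ w = expi s).
Proof.
intros HP.
(* X and Y are the real and imaginary parts of w exp(- i t). *)
pose (X := fun w : C => fst w * cos t + snd w * sin t).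
pose (Y := fun w : C => snd w * cos t - fst w * sin t).
assert (E : cos t * cos t + sin t * sin t = 1).
{ generalize (sin2_cos2 t); unfold Rsqr; lra. }
assert (X1 : X (expi t) = 1) by (unfold X; rewrite expi_cos_sin; exact E).
assert (Y0 : Y (expi t) = 0) by (unfold Y; rewrite expi_cos_sin; simpl; ring).
assert (CX : continuous X (expi t)).
{ apply (continuous_plus (fun w : C => fst w * cos t) (fun w : C => snd w * sin t)).
  - apply (continuous_mult (fun w : C => fst w) (fun _ : C => cos t));
      [apply continuous_fst | apply continuous_const].
  - apply (continuous_mult (fun w : C => snd w) (fun _ : C => sin t));
      [apply continuous_snd | apply continuous_const]. }
assert (CY : continuous Y (expi t)).
{ apply (continuous_minus (fun w : C => snd w * cos t) (fun w : C => fst w * sin t)).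
  - apply (continuous_mult (fun w : C => snd w) (fun _ : C => cos t));
      [apply continuous_snd | apply continuous_const].
  - apply (continuous_mult (fun w : C => fst w) (fun _ : C => sin t));
      [apply continuous_fst | apply continuous_const]. }
assert (CA : continuous (fun w => t + atan (Y w / X w)) (expi t)).
{ apply (continuous_plus (fun _ : C => t) (fun w => atan (Y w / X w)));
    [apply continuous_const|].
  apply (continuous_comp (fun w => Y w / X w) atan).
  - apply (continuous_mult Y (fun w => / X w)); [exact CY|].
    apply (continuous_comp X Rinv); [exact CX|].
    apply continuous_Rinv; rewrite X1; lra.
  - apply (ex_derive_continuous (K := R_AbsRing) (V := R_NormedModule) atan).
    eexists; apply is_derive_atan. }
assert (LX : locally (expi t) (fun w => 0 < X w)).
{ apply CX, (open_gt 0); rewrite X1; lra. }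
assert (LP : locally (expi t) (fun w => P (t + atan (Y w / X w)))).
{ apply CA; rewrite X1, Y0, Rdiv_0_l, atan_0, Rplus_0_r; exact HP. }
unfold within; generalize (filter_and _ _ LX LP); apply filter_imp.
intros w [Hx Hp] Hw; exists (t + atan (Y w / X w)); split; [exact Hp|].
destruct w as [x y]; apply Cmod_eq_1 in Hw.
rewrite expi_plus, expi_atan; [| exact Hx |].
- rewrite expi_cos_sin; unfold Cmult, X, Y; simpl; f_equal.
  + transitivity (x * (cos t * cos t + sin t * sin t)); [rewrite E|]; ring.
  + transitivity (y * (cos t * cos t + sin t * sin t)); [rewrite E|]; ring.
- unfold X, Y; simpl.
  transitivity ((x ^ 2 + y ^ 2) * (cos t * cos t + sin t * sin t)); [ring|].
  rewrite E, Hw; ring.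
Qed.

(** * Derivative along the circle and derivative in the angle *)

(** The two cruder bounds say that chord and arc are comparable; they follow
    from the first estimate with [1/2] in place of [eps], since the derivative
    of [expi] has modulus one. *)
Lemma expi_first_order (t : R) (eps : posreal) :
  locally t (fun s =>
    Cmod (expi s - expi t - RtoC (s - t) * (Ci * expi t))%C <= eps * Rabs (s - t)
    /\ Cmod (expi s - expi t)%C <= 2 * Rabs (s - t)
    /\ Rabs (s - t) <= 2 * Cmod (expi s - expi t)%C).
Proof.
assert (H : is_derive expi t (Ci * expi t)%C).
{ evar_last; [apply (is_derive_expi_comp (fun s => s)); apply is_derive_id|].
  apply Cmult_1_l. }
assert (Hh : 0 < / 2) by lra.
generalize (filter_and _ _ (proj1 (is_derive_C_iff _ _ _) H eps)
              (proj1 (is_derive_C_iff _ _ _) H (mkposreal _ Hh))).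
apply filter_imp; intros s [H1 H2]; split; [exact H1|]; simpl in H2.
set (c := (expi s - expi t)%C) in *; set (l := (RtoC (s - t) * (Ci * expi t))%C) in *.
assert (El : Cmod l = Rabs (s - t)).
{ unfold l; rewrite !Cmod_mult, Cmod_R, Cmod_Ci, Cmod_expi; ring. }
generalize (Cmod_triangle (c - l) l) (Cmod_triangle c (- (c - l))).
rewrite Cmod_opp.
replace (c - l + l)%C with c by ring.
replace (c + - (c - l))%C with l by ring.
lra.
Qed.

(** Both directions combine a first-order estimate of [f] with the one of
    [expi], whose error is amplified by [|l|]; the comparison of chord and arc
    turns bounds in [s - t] into bounds in [expi s - expi t] and back. *)
Lemma is_derive_circle_expi (f : C -> C) (t : R) (l : C) :
  is_derive_circle f (expi t) l <->
  is_derive (fun s => f (expi s)) t (l * (Ci * expi t))%C.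
Proof.
rewrite is_derive_circle_iff, is_derive_C_iff.
assert (Hl : 0 < 1 + Cmod l) by (generalize (Cmod_ge_0 l); lra).
split; intros H eps.
- assert (Hd : 0 < eps / 4) by (generalize (cond_pos eps); lra).
  assert (He : 0 < eps / 2 / (1 + Cmod l)).
  { apply Rdiv_lt_0_compat; [generalize (cond_pos eps); lra | exact Hl]. }
  assert (HC : continuous expi t).
  { apply (ex_derive_continuous (K := R_AbsRing) (V := prod_NormedModule _ _ _) expi).
    eexists; apply (is_derive_expi_comp (fun s => s)), is_derive_id. }
  assert (H0 := HC _ (H (mkposreal _ Hd))); unfold filtermap in H0.
  generalize (filter_and _ _ H0 (expi_first_order t (mkposreal _ He))).
  apply filter_imp; simpl; intros s [H1 [H2 [H3 _]]].
  specialize (H1 (Cmod_expi s)).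
  set (c := (expi s - expi t)%C) in *.
  replace (f (expi s) - f (expi t) - RtoC (s - t) * (l * (Ci * expi t)))%C
    with ((f (expi s) - f (expi t) - c * l) + l * (c - RtoC (s - t) * (Ci * expi t)))%C
    by ring.
  eapply Rle_trans; [apply Cmod_triangle|]; rewrite Cmod_mult.
  apply Rle_trans with (eps / 4 * (2 * Rabs (s - t))
    + (1 + Cmod l) * (eps / 2 / (1 + Cmod l) * Rabs (s - t))).
  + apply Rplus_le_compat.
    * eapply Rle_trans; [exact H1|]; apply Rmult_le_compat_l; lra.
    * apply Rmult_le_compat; [apply Cmod_ge_0|apply Cmod_ge_0|lra|exact H2].
  + right; field; lra.
- assert (Hd : 0 < eps / 4) by (generalize (cond_pos eps); lra).
  assert (He : 0 < eps / 4 / (1 + Cmod l)) by (now apply Rdiv_lt_0_compat).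
  generalize (unit_circle_local_angle t _
    (filter_and _ _ (H (mkposreal _ Hd)) (expi_first_order t (mkposreal _ He)))).
  apply filter_imp; simpl; intros w [s [[H1 [H2 [_ H3]]] ->]].
  set (c := (expi s - expi t)%C) in *.
  replace (f (expi s) - f (expi t) - c * l)%C
    with ((f (expi s) - f (expi t) - RtoC (s - t) * (l * (Ci * expi t)))
          + - (l * (c - RtoC (s - t) * (Ci * expi t))))%C by ring.
  eapply Rle_trans; [apply Cmod_triangle|]; rewrite Cmod_opp, Cmod_mult.
  apply Rle_trans with (eps / 4 * (2 * Cmod c)
    + (1 + Cmod l) * (eps / 4 / (1 + Cmod l) * (2 * Cmod c))).
  + apply Rplus_le_compat.
    * eapply Rle_trans; [exact H1|]; apply Rmult_le_compat_l; lra.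
    * apply Rmult_le_compat; [apply Cmod_ge_0|apply Cmod_ge_0|lra|].
      eapply Rle_trans; [exact H2|]; apply Rmult_le_compat_l; lra.
  + right; field; lra.
Qed.

(** * The Riccati field on the torus *)

(** [torus_rhs] with [cos theta] replaced by a free variable, so that it makes
    sense for a point [Phi] of the circle, through [c = Re Phi], before any
    angle of [Phi] has been chosen. *)
Definition torus_field (omega A B D c tau : R) : R :=
  (c + B + A * sin tau) / (omega * (1 - cos tau)) + D.

Lemma ex_derive_torus_field (c : R -> R) (omega A B D tau : R) :
  ex_derive c tau -> omega <> 0 -> 1 - cos tau <> 0 ->
  ex_derive (fun s => torus_field omega A B D (c s) s) tau.
Proof.
intros Hc Ho Ht; unfold torus_field; auto_derive; repeat split; [exact Hc|].
now apply Rmult_integral_contrapositive_currified.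
Qed.

Lemma regular_cos (tau : R) : regular tau -> 0 < 1 - cos tau.
Proof.
intros H.
assert (E : 1 - cos tau = 2 * (sin (tau / 2)) ^ 2).
{ replace tau with (2 * (tau / 2)) at 1 by field; rewrite cos_2a_sin; ring. }
assert (N : sin (tau / 2) <> 0).
{ intros Hs; apply sin_eq_0_0 in Hs; destruct Hs as [k Hk].
  apply (H k); lra. }
rewrite E; nra.
Qed.

(** The factor of [i Phi] on the right is real: the Riccati field is tangent to
    the torus. *)
Lemma riccati_on_torus (b g : R) (nu Phi : C) (tau : R) :
  b <> 0 -> regular tau -> Cmod Phi = 1 ->
  (riccati_rhs b g nu (expi tau) Phi * (Ci * expi tau)
   = RtoC (torus_field (1 / b) (Im nu / b) (g / (2 * b)) (- Re nu) (Re Phi) tau)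
     * (Ci * Phi))%C.
Proof.
intros Hb Hr HPhi; apply regular_cos in Hr.
assert (Hz : expi tau <> 0%C) by apply expi_neq_0.
assert (Hd : (expi tau - 1)%C <> 0%C).
{ rewrite expi_cos_sin; intros E; apply (f_equal fst) in E; simpl in E; lra. }
assert (T : cos tau * cos tau + sin tau * sin tau = 1).
{ generalize (sin2_cos2 tau); unfold Rsqr; lra. }
assert (E1 : (expi tau = RtoC (- / (2 * (1 - cos tau))) * (expi tau - 1) ^ 2)%C).
{ rewrite expi_cos_sin; unfold Cminus, Cplus, Copp, Cmult, RtoC; simpl.
  apply injective_projections; simpl; field_simplify_eq; try lra; nra. }
assert (E2 : (expi tau
  = ((/ 2)%R, (- (sin tau / (2 * (1 - cos tau))))%R) * (expi tau - 1))%C).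
{ rewrite expi_cos_sin; unfold Cminus, Cplus, Copp, Cmult, RtoC; simpl.
  apply injective_projections; simpl; field_simplify_eq; try lra; nra. }
assert (E3 : (1 + Phi ^ 2 = RtoC (2 * Re Phi) * Phi)%C).
{ destruct Phi as [x y]; apply Cmod_eq_1 in HPhi; simpl.
  apply injective_projections; simpl; nra. }
assert (E4 : (expi tau / (expi tau - 1) ^ 2)%C = RtoC (- / (2 * (1 - cos tau)))).
{ rewrite E1 at 1; field; exact Hd. }
assert (E5 : (expi tau / (expi tau - 1))%C
  = ((/ 2)%R, (- (sin tau / (2 * (1 - cos tau))))%R)).
{ rewrite E2 at 1; field; exact Hd. }
transitivity ((- (RtoC b * (expi tau / (expi tau - 1) ^ 2)) * RtoC (2 * Re Phi)
  + (- nu - RtoC g * (expi tau / (expi tau - 1) ^ 2)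
     + (nu - Cconj nu) * (expi tau / (expi tau - 1)))) * (Ci * Phi))%C.
{ unfold riccati_rhs; rewrite E3; field; split; assumption. }
f_equal; rewrite E4, E5; destruct nu as [p q]; unfold torus_field; simpl.
apply injective_projections; simpl; field; lra.
Qed.

(** * Continuous angles along curves in the circle *)

Lemma locally_interval (t0 t1 t : R) :
  t0 < t < t1 -> locally t (fun s => t0 < s < t1).
Proof.
intros [H0 H1]; apply filter_and; [now apply open_gt | now apply open_lt].
Qed.

(** Let [theta] be a primitive of [h] that is an angle of [f] at one point.
    Then [f exp(- i theta)] has derivative zero.  Its real part suffices: a
    number of modulus one with real part [1] is [1]. *)
Lemma continuous_angle_of_circle_curve (f : R -> C) (h : R -> R) (t0 t1 : R) :
  (forall t, t0 < t < t1 -> Cmod (f t) = 1) ->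
  (forall t, t0 < t < t1 -> is_derive f t (RtoC (h t) * (Ci * f t))%C) ->
  (forall t, t0 < t < t1 -> continuous h t) ->
  exists theta : R -> R, forall t, t0 < t < t1 ->
    continuous theta t /\ f t = expi (theta t).
Proof.
intros Hm Hf Hh.
destruct (Rlt_dec t0 t1) as [Ht|Ht]; [|exists (fun _ => 0); intros t Htt; lra].
pose (c := (t0 + t1) / 2).
assert (Hc : t0 < c < t1) by (unfold c; lra).
destruct (expi_surjective _ (Hm c Hc)) as [a Ha].
pose (theta := fun t => a + RInt h c t).
assert (Hth : forall t, t0 < t < t1 -> is_derive theta t (h t)).
{ intros t Htt; unfold theta.
  evar_last; [apply (is_derive_plus (fun _ => a) (RInt h c));
    [apply is_derive_const | apply (is_derive_RInt h _ c)] | apply plus_zero_l].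
  - apply (filter_imp (fun s => t0 < s < t1)).
    + intros s Hs; apply (RInt_correct (V := R_CompleteNormedModule)).
      apply (ex_RInt_continuous (V := R_CompleteNormedModule)).
      intros x Hx; apply Hh; revert Hx; unfold Rmin, Rmax.
      destruct (Rle_dec c s); lra.
    + now apply locally_interval.
  - now apply Hh. }
exists theta; intros t Htt; split.
{ apply (ex_derive_continuous (K := R_AbsRing) (V := R_NormedModule) theta).
  eexists; now apply Hth. }
(* The real part of f exp(- i theta). *)
pose (p := fun s => fst (f s) * cos (theta s) + snd (f s) * sin (theta s)).
assert (Hp : forall s, t0 < s < t1 -> is_derive p s 0).
{ intros s Hs; specialize (Hf s Hs); apply is_derive_C_components in Hf.
  destruct Hf as [F1 F2].
  assert (T := Hth s Hs).
  unfold p.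
  evar_last.
  - apply (is_derive_plus (fun s => fst (f s) * cos (theta s))
             (fun s => snd (f s) * sin (theta s))).
    + apply (is_derive_mult (fun s => fst (f s)) (fun s => cos (theta s))).
      * exact F1.
      * apply (is_derive_comp cos theta); [apply is_derive_cos | exact T].
      * exact Rmult_comm.
    + apply (is_derive_mult (fun s => snd (f s)) (fun s => sin (theta s))).
      * exact F2.
      * apply (is_derive_comp sin theta); [apply is_derive_sin | exact T].
      * exact Rmult_comm.
  - unfold plus, mult, scal; simpl; unfold mult; simpl; ring. }
assert (p1 : p c = 1).
{ unfold p, theta; rewrite RInt_point; change zero with 0.
  rewrite Rplus_0_r, Ha, expi_cos_sin; simpl.
  generalize (sin2_cos2 a); unfold Rsqr; lra. }
assert (pt : p t = 1).
{ destruct (Rtotal_order c t) as [H|[<-|H]]; [|exact p1|].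
  - rewrite <- p1; symmetry; apply eq_is_derive; [intros s Hs; apply Hp; lra | exact H].
  - rewrite <- p1; apply eq_is_derive; [intros s Hs; apply Hp; lra | exact H]. }
assert (M := Hm t Htt); unfold p in pt; destruct (f t) as [x y]; simpl in pt.
apply Cmod_eq_1 in M; rewrite expi_cos_sin.
assert (E := sin2_cos2 (theta t)); unfold Rsqr in E.
assert (Z : (x - cos (theta t))² + (y - sin (theta t))² = 0) by (unfold Rsqr; nra).
apply Rplus_sqr_eq_0 in Z; destruct Z.
apply injective_projections; simpl; lra.
Qed.

(** * The variable change *)

Theorem proposition23 :
  forall (b g : R) (nu : C), b <> 0 ->
  forall omega A B D : R,
    omega = 1 / b ->
    B = g / (2 * b) ->
    A = Im nu / b ->
    D = - Re nu ->
    (* Line fields: a curve (theta, tau) is tangent to the torus equation iff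
       its image (exp(i theta), exp(i tau)) is tangent to the Riccati
       equation dPhi = riccati_rhs dz. *)
    (forall (theta tau : R -> R) (t dtheta dtau : R) (dPhi dz : C),
       regular (tau t) ->
       is_derive theta t dtheta ->
       is_derive tau t dtau ->
       is_derive (fun s : R => expi (theta s)) t dPhi ->
       is_derive (fun s : R => expi (tau s)) t dz ->
       (dPhi = (riccati_rhs b g nu (expi (tau t)) (expi (theta t)) * dz)%C <->
        dtheta = torus_rhs omega A B D (theta t) (tau t) * dtau)) /\
    (* Solutions over any interval of regular times. *)
    (forall t0 t1 : R,
       (forall tau : R, t0 < tau < t1 -> regular tau) ->
       (forall (theta : R -> R) (Phi : C -> C),
          variable_change t0 t1 theta Phi ->
          (riccati_solution_on_torus b g nu t0 t1 Phi <->
           torus_solution omega A B D t0 t1 theta)) /\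
       (forall Phi : C -> C,
          riccati_solution_on_torus b g nu t0 t1 Phi ->
          exists theta : R -> R, variable_change t0 t1 theta Phi)).
Proof.
intros b g nu Hb omega A B D -> -> -> ->.
split; [|intros t0 t1 Hreg; split].
- intros theta tau t dtheta dtau dPhi dz Hr Htheta Htau HPhi Hz.
  rewrite (is_derive_C_unique _ _ _ _ HPhi (is_derive_expi_comp _ _ _ Htheta)).
  rewrite (is_derive_C_unique _ _ _ _ Hz (is_derive_expi_comp _ _ _ Htau)).
  assert (K := riccati_on_torus b g nu (expi (theta t)) (tau t) Hb Hr (Cmod_expi _)).
  set (T := torus_rhs _ _ _ _ _ _).
  assert (ET : torus_field (1 / b) (Im nu / b) (g / (2 * b)) (- Re nu)
                 (Re (expi (theta t))) (tau t) = T).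
  { rewrite expi_cos_sin; reflexivity. }
  rewrite ET in K.
  replace (riccati_rhs b g nu (expi (tau t)) (expi (theta t)) *
    (RtoC dtau * (Ci * expi (tau t))))%C
    with (RtoC dtau * (riccati_rhs b g nu (expi (tau t)) (expi (theta t)) *
                         (Ci * expi (tau t))))%C by ring.
  rewrite K; replace (RtoC dtau * (RtoC T * (Ci * expi (theta t))))%C
    with (RtoC (T * dtau) * (Ci * expi (theta t)))%C by (rewrite RtoC_mult; ring).
  split; [|intros ->; reflexivity].
  intros E; apply RtoC_inj, Ceq_minus.
  assert (N : (Ci * expi (theta t))%C <> 0%C).
  { apply Cmult_neq_0; [|apply expi_neq_0].
    apply Cmod_gt_0; rewrite Cmod_Ci; lra. }
  apply Ceq_minus in E.
  destruct (Ceq_dec (RtoC dtheta - RtoC (T * dtau))%C 0%C) as [|N']; [assumption|].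
  destruct (Cmult_neq_0 _ _ N' N); rewrite <- E; ring.
- intros theta Phi Hvar.
  (* Derivatives at tau only see Phi o expi near tau, where it is expi o theta. *)
  assert (Hloc : forall tau, t0 < tau < t1 ->
    locally tau (fun s => Phi (expi s) = expi (theta s))).
  { intros tau Htau; generalize (locally_interval _ _ _ Htau).
    apply filter_imp; intros s Hs; now apply Hvar. }
  assert (Hl : forall tau, t0 < tau < t1 ->
    (riccati_rhs b g nu (expi tau) (Phi (expi tau)) * (Ci * expi tau)
     = RtoC (torus_rhs (1 / b) (Im nu / b) (g / (2 * b)) (- Re nu) (theta tau) tau)
       * (Ci * expi (theta tau)))%C).
  { intros tau Htau; destruct (Hvar tau Htau) as [_ ->].
    rewrite (riccati_on_torus b g nu _ tau Hb (Hreg _ Htau) (Cmod_expi _)).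
    now rewrite (expi_cos_sin (theta tau)). }
  split.
  + intros Hric tau Htau; destruct (Hvar tau Htau) as [Hc He].
    destruct (Hric tau Htau) as [_ Hd].
    apply is_derive_circle_expi in Hd; rewrite Hl in Hd by assumption.
    apply is_derive_of_expi; [exact Hc|].
    revert Hd; apply is_derive_ext_loc, Hloc, Htau.
  + intros Htor tau Htau; split.
    * destruct (Hvar tau Htau) as [_ ->]; apply Cmod_expi.
    * apply is_derive_circle_expi; rewrite Hl by assumption.
      apply (is_derive_ext_loc (fun s => expi (theta s))).
      { generalize (Hloc tau Htau); apply filter_imp; intros s; apply eq_sym. }
      now apply is_derive_expi_comp, Htor.
- intros Phi Hric.
  pose (h := fun tau => torus_field (1 / b) (Im nu / b) (g / (2 * b)) (- Re nu)
                          (Re (Phi (expi tau))) tau).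
  assert (Hd : forall tau, t0 < tau < t1 ->
    is_derive (fun s => Phi (expi s)) tau (RtoC (h tau) * (Ci * Phi (expi tau)))%C).
  { intros tau Htau; destruct (Hric tau Htau) as [Hm H].
    apply is_derive_circle_expi in H.
    now rewrite (riccati_on_torus b g nu _ tau Hb (Hreg _ Htau) Hm) in H. }
  apply (continuous_angle_of_circle_curve (fun s => Phi (expi s)) h).
  + intros tau Htau; now apply Hric.
  + exact Hd.
  + intros tau Htau.
    apply (ex_derive_continuous (K := R_AbsRing) (V := R_NormedModule) h).
    specialize (Hd tau Htau); apply is_derive_C_components in Hd; destruct Hd as [Hd _].
    assert (N := regular_cos tau (Hreg tau Htau)).
    apply (ex_derive_torus_field (fun s => Re (Phi (expi s)))).
    * eexists; exact Hd.
    * unfold Rdiv; rewrite Rmult_1_l; now apply Rinv_neq_0_compat.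
    * lra.
Qed.
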